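(* For any function $\omega:(0,\infty)\to(0,\infty)$ and any $\tau>2$ there exists a non-increasing function $\Psi:(0,\infty)\to(0,\infty)$ such that $\lim_{q\to\infty}\frac{-\log\Psi(q)}{\log q}=\tau$ and $E(\Psi,\omega)\neq\emptyset$.
   Context: $W(\Psi)$ denotes the set of $x\in\mathbb{R}$ with $|x-p/q|\le\Psi(q)$ for infinitely many $(p,q)\in\mathbb{Z}\times\mathbb{N}$. For functions $\Psi,\omega$ on $(0,\infty)$, $E(\Psi,\omega)$ denotes the set of $x\in W(\Psi)$ such that for all $q\in\mathbb{N}$ sufficiently large, $|x-p/q|\ge(1-\omega(q))\Psi(q)$ for all $p\in\mathbb{Z}$. *)

(* Defs.v *)
From HB Require Import structures.
From mathcomp Require Import all_boot all_order all_algebra.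
From mathcomp Require Import all_classical all_reals all_analysis.

Set Implicit Arguments.
Unset Strict Implicit.
Unset Printing Implicit Defensive.

Import Order.TTheory GRing.Theory Num.Theory.
Import numFieldNormedType.Exports.

Local Open Scope classical_set_scope.
Local Open Scope ring_scope.

(* Functions (0, oo) -> (0, oo) are represented by total functions R -> R;
   their values at q <= 0 are irrelevant to every definition below. *)
Definition maps_pos_to_pos (R : realType) (f : R -> R) : Prop :=
  forall q : R, 0 < q -> 0 < f q.

(* The denominators range over the positive integers, and the pairs (p, q) are
   counted as pairs: p and q need not be coprime. *)
Definition W (R : realType) (Psi : R -> R) : set R :=
  [set x : R | infinite_set
     [set pq : int * nat |
        (0 < pq.2)%N /\ `|x - pq.1%:~R / pq.2%:R| <= Psi pq.2%:R]].

Definition E (R : realType) (Psi omega : R -> R) : set R :=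
  [set x : R | W Psi x /\
     \forall q \near \oo%N, forall p : int,
       (1 - omega q%:R) * Psi q%:R <= `|x - p%:~R / q%:R|].

(* Main.v *)
Require Import Defs.
From HB Require Import structures.
From mathcomp Require Import all_boot all_order all_algebra.
From mathcomp Require Import all_classical all_reals all_analysis.
From mathcomp Require Import zify ring lra.

Set Implicit Arguments.
Unset Strict Implicit.
Unset Printing Implicit Defensive.

Import Order.TTheory GRing.Theory Num.Theory.
Import numFieldNormedType.Exports.

Local Open Scope classical_set_scope.
Local Open Scope ring_scope.

(* Take x to be a continued fraction with minus signs whose convergents p_k / q_k
   satisfy q_(k+1) ~ q_k^(tau-1), so that x - p_k / q_k is of order q_k^(-tau).
   A fraction m / n with 4 n <= q_(k+1) is either equal to p_k / q_k or at
   distance at least 1 / (2 n q_k) from x. Hence |x - m/n| is bounded below by a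
   multiple of n^(-tau), and every p_k / q_k is a best approximation to x among
   the fractions with denominator at most q_k. Let Psi t be the infimum of
   2 t^(-tau) and of all |x - m/n| with n <= t: it has order tau, no fraction m/n
   is strictly closer to x than Psi n, and every p_k / q_k is within Psi q_k. *)

(** Taking logarithms squeezes the quotient between [tau - ln C / ln q] and [tau - ln c / ln q],
    where the constants die out. *)
Lemma cvg_Nln_div_ln (R : realType) (f : R -> R) (c C tau : R) :
  0 < c -> 0 < C ->
  (forall q, 0 < q -> c * q `^ (- tau) <= f q <= C * q `^ (- tau)) ->
  - ln (f q) / ln q @[q --> +oo] --> tau.
Proof.
move=> c0 C0 fcC.
have lnV0 : (ln q)^-1 @[q --> (+oo : set_system R)] --> (0 : R).
  apply/gtr0_cvgV0.
    near=> q; apply: ln_gt0; near: q; exact: nbhs_pinfty_gt.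
  apply/cvgryPge => A; near=> q.
  rewrite -[A]expRK ler_ln ?posrE ?expR_gt0//.
have lim (b : R) : tau - ln b * (ln q)^-1 @[q --> +oo] --> tau.
  rewrite -[X in _ --> X]subr0 -(mulr0 (ln b)).
  by apply: cvgB; [exact: cvg_cst|apply: cvgM => //; exact: cvg_cst].
apply: (squeeze_cvgr _ (lim C) (lim c)); near=> q.
have q1 : 1 < q by near: q; exact: nbhs_pinfty_gt.
have q0 : 0 < q by exact: lt_trans q1.
have lq0 : 0 < ln q by exact: ln_gt0.
have qt0 : 0 < q `^ (- tau) by exact: powR_gt0.
have /andP[cf fC] := fcC _ q0.
have f0 : 0 < f q by apply: lt_le_trans cf; exact: mulr_gt0.
have lnE b : 0 < b -> ln (b * q `^ (- tau)) = ln b - tau * ln q.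
  by move=> b0; rewrite lnM ?posrE// ln_powR mulNr.
have bE b : tau - ln b / ln q = - (ln b - tau * ln q) / ln q.
  by rewrite opprB mulrBl mulfK// gt_eqF.
rewrite !bE !ler_pM2r ?invr_gt0// !lerN2 -!lnE//.
by rewrite !ler_ln ?posrE ?mulr_gt0// cf fC.
Unshelve. all: by end_near. Qed.

(* p k / q k are the convergents of 1 / (4 - 1 / (a (q 1) - 1 / (a (q 2) - ..))).
   The minus signs make them approach their limit from below. *)
Lemma ex_minus_continued_fraction (a : nat -> nat) : (forall n, 5 <= a n)%N ->
  exists (p : nat -> int) (q : nat -> nat),
    [/\ q 0%N = 1%N /\ q 1%N = 4%N,
        forall k, (0 < q k)%N,
        forall k, (4 * q k <= q k.+1)%N,
        forall k, p k.+1 * (q k)%:Z = p k * (q k.+1)%:Z + 1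
      & forall k, (q k.+2 + q k = a (q k.+1) * q k.+1)%N].
Proof.
move=> a5.
(* A state holds two consecutive convergents. The partial quotient depends on the latest
   denominator, so the growth of [q] can be prescribed through [a]. *)
pose step (s : (int * nat) * (int * nat)) :=
  (s.2, (s.2.1 * (a s.2.2)%:Z - s.1.1, (a s.2.2 * s.2.2 - s.1.2)%N)).
pose s k := iter k step ((0, 1%N), (1, 4%N)).
have inv k : [/\ (0 < (s k).1.2)%N, (4 * (s k).1.2 <= (s k).2.2)%N
    & (s k).2.1 * (s k).1.2%:Z = (s k).1.1 * (s k).2.2%:Z + 1].
  elim: k => [//|k [h0 h4 hdet]]; rewrite /s iterS -/(s k) /step /=.
  move: h0 h4 hdet (a5 (s k).2.2); case: (s k) => -[p q] [p' q'] /=.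
  move: (a q') => b h0 h4 hdet b5.
  (* Keeps the subtraction of denominators in [nat] from truncating. *)
  have qb : (q <= b * q')%N by nia.
  split; [lia|nia|].
  rewrite -subzn// PoszM; nia.
exists (fun k => (s k).1.1), (fun k => (s k).1.2).
have sS k : (s k.+1).1 = (s k).2 by [].
split=> //.
- by move=> k; case: (inv k).
- by move=> k; rewrite sS; case: (inv k).
- by move=> k; rewrite sS; case: (inv k).
- move=> k; rewrite !sS /s iterS -/(s k) /step /= -/(s k) subnK//.
  case: (inv k) => h0 h4 _; have := a5 (s k).2.2; nia.
Qed.
(** The determinant identity makes the increments of p_k / q_k equal to d_k = 1 / (q_k q_(k+1)), and
    d_(k+1) <= d_k / 2. The convergents thus increase, and those after p_k / q_k add at least d_k
    and at most 2 d_k. *)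
Lemma minus_continued_fraction_limit (R : realType)
    (p : nat -> int) (q : nat -> nat) :
  (forall k, 0 < q k)%N -> (forall k, 4 * q k <= q k.+1)%N ->
  (forall k, p k.+1 * (q k)%:Z = p k * (q k.+1)%:Z + 1) ->
  exists x : R, forall k,
    ((q k)%:R * (q k.+1)%:R)^-1 <= x - (p k)%:~R / (q k)%:R
      <= 2 * ((q k)%:R * (q k.+1)%:R)^-1.
Proof.
move=> q0 q4 det.
pose Q k : R := (q k)%:R; pose r k : R := (p k)%:~R / Q k.
pose d k : R := (Q k * Q k.+1)^-1.
have Q0 k : 0 < Q k by rewrite ltr0n.
have Q4 k : 4 * Q k <= Q k.+1 by rewrite -natrM ler_nat.
have d0 k : 0 < d k by rewrite invr_gt0 mulr_gt0.
have rS k : r k.+1 = r k + d k.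
  have /(congr1 (fun z => z%:~R : R)) := det k.
  rewrite rmorphD !rmorphM /= -!pmulrn rmorph1 => h.
  have Qk := gt_eqF (Q0 k); have QSk := gt_eqF (Q0 k.+1).
  rewrite /r /d; apply: (mulIf (x := Q k * Q k.+1)).
    by rewrite mulf_neq0 ?Qk ?QSk.
  rewrite mulrDl mulVf ?mulf_neq0 ?Qk ?QSk// mulrCA mulfVK ?QSk//.
  by rewrite mulrC h mulrA divfK ?Qk.
have dS k : d k.+1 <= d k / 2.
  rewrite -invfM lef_pV2 ?posrE ?mulr_gt0//.
  have := Q4 k; have := Q4 k.+1; have := Q0 k; have := Q0 k.+1; nra.
pose s k := r k + 2 * d k.
have r_mono j k : (j <= k)%N -> r j <= r k.
  move=> /subnK <-; elim: (k - j)%N => // n IH; rewrite addSn rS.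
  by apply: le_trans IH _; rewrite lerDl ltW.
have s_anti j k : (j <= k)%N -> s k <= s j.
  move=> /subnK <-; elim: (k - j)%N => // n; apply: le_trans.
  by rewrite addSn /s rS; have := dS (n + j)%N; lra.
have rs j k : r j <= s k.
  have rsk i : r i <= s i by rewrite lerDl mulr_ge0// ltW.
  case: (leqP j k) => [jk|/ltnW kj]; first exact: le_trans (r_mono _ _ jk) _.
  by apply: le_trans (rsk j) _; exact: s_anti.
have ubr : has_ubound (range r) by exists (s 0%N) => _ [j _ <-].
exists (sup (range r)) => k; apply/andP; split.
  rewrite lerBrDl -/(Q k) -/(r k) -/(d k) -rS.
  by apply: ub_le_sup => //; exists k.+1.
rewrite lerBlDl; apply: ge_sup; first by exists (r 0%N), 0%N.
by move=> _ [j _ <-]; exact: rs.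
Qed.

(* A fraction distinct from p k / q k differs from it by at least 1 / (n q k),
   which dominates twice the distance from x to p k / q k. *)
Lemma dist_frac_ge (R : realType) (x : R) (u m : int) (q q' n : nat) :
  (0 < q)%N -> (0 < n)%N -> (4 * n <= q')%N ->
  0 <= x - u%:~R / q%:R <= 2 * (q%:R * q'%:R)^-1 ->
  m * q%:Z <> u * n%:Z ->
  (2 * n%:R * q%:R)^-1 <= `|x - m%:~R / n%:R|.
Proof.
move=> q0 n0 nq' /andP[xr0 xr] mu.
have Q0 : 0 < q%:R :> R by rewrite ltr0n.
have N0 : 0 < n%:R :> R by rewrite ltr0n.
have NQ' : 4 * n%:R <= q'%:R :> R by rewrite -natrM ler_nat.
have Q'0 : 0 < q'%:R :> R by lra.
have sep : (n%:R * q%:R)^-1 <= `|u%:~R / q%:R - m%:~R / n%:R| :> R.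
  have -> : u%:~R / q%:R - m%:~R / n%:R
      = (u * n%:Z - m * q%:Z)%:~R / (n%:R * q%:R) :> R.
    by rewrite rmorphB !rmorphM /= -!pmulrn; field; rewrite !gt_eqF.
  rewrite normrM normfV (gtr0_norm (mulr_gt0 N0 Q0)).
  apply: ler_peMl; first by rewrite invr_ge0 mulr_ge0// ltW.
  by rewrite -intr_norm -[1]/(1%:~R) ler_int; lia.
have close : 2 * (q%:R * q'%:R)^-1 <= (2 * n%:R * q%:R)^-1 :> R.
  rewrite -[X in X * _](invrK 2) -invfM lef_pV2 ?posrE ?mulr_gt0 ?invr_gt0//.
  nra.
have half : (n%:R * q%:R)^-1 = 2 * (2 * n%:R * q%:R)^-1 :> R.
  by field; rewrite !gt_eqF.
have := ler_distD x (u%:~R / q%:R) (m%:~R / n%:R).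
rewrite (distrC _ x) (ger0_norm xr0); lra.
Qed.
Lemma ex_order_with_record_fractions (R : realType) (tau : R) : 2 < tau ->
  exists (x : R) (p : nat -> int) (q : nat -> nat),
    [/\ forall k, (0 < q k < q k.+1)%N,
        forall (n : nat) (m : int), (0 < n)%N ->
          8^-1 * (4 * n%:R) `^ (- tau) <= `|x - m%:~R / n%:R|,
        forall k, `|x - (p k)%:~R / (q k)%:R| <= 2 * (q k)%:R `^ (- tau)
      & forall k (n : nat) (m : int), (0 < n <= q k)%N ->
          `|x - (p k)%:~R / (q k)%:R| <= `|x - m%:~R / n%:R|].
Proof.
move=> tau2.
(* A partial quotient near q^(tau-2) gives q_(k+1) of order q_k^(tau-1). *)
pose a n := ((Num.trunc (n%:R `^ (tau - 2))) + 5)%N.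
have [|p [q [[q0E q1E] q0 q4 det recq]]] := @ex_minus_continued_fraction a.
  by move=> n; rewrite leq_addl.
have [x xr] := @minus_continued_fraction_limit R p q q0 q4 det.
pose Q k : R := (q k)%:R; pose r k : R := (p k)%:~R / Q k.
have Q0 k : 0 < Q k by rewrite ltr0n.
have Q1 k : 1 <= Q k by rewrite ler1n.
have Q4 k : 4 * Q k <= Q k.+1 by rewrite -natrM ler_nat.
pose d k : R := (Q k * Q k.+1)^-1.
have d0 k : 0 < d k by rewrite invr_gt0 mulr_gt0.
have xrk k : d k <= x - r k <= 2 * d k by exact: xr.
have xr0 k : 0 <= x - r k <= 2 * d k.
  by have /andP[h ->] := xrk k; rewrite (le_trans _ h)// ltW.
(* With t = q_k^(tau-2) >= 1, the partial quotient lies in [t + 4, t + 5]: the 4 absorbs the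
   subtracted q_(k-1), and t + 5 <= 6 t. For k = 0 the product is 4. *)
have growth k : Q k `^ tau <= Q k * Q k.+1 <= 6 * Q k `^ tau.
  have tE : Q k `^ tau = Q k `^ (tau - 2) * (Q k * Q k).
    rewrite -expr2 -(powR_mulrn 2 (ltW (Q0 k))) -powRD ?subrK//.
    by rewrite (gt_eqF (Q0 k)) /= implybT.
  have t1 : 1 <= Q k `^ (tau - 2).
    by rewrite -[leLHS](powRr0 (Q k)) ler_powR// subr_ge0 ltW.
  case: k => [|k] in tE t1 *.
    by rewrite /Q q0E q1E powR1; apply/andP; split; lra.
  have aitv : Q k.+1 `^ (tau - 2) + 4 <= (a (q k.+1))%:R
      <= Q k.+1 `^ (tau - 2) + 5.
    rewrite /a natrD.
    have /andP[h1 h2] := truncn_itv (le_trans ler01 t1).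
    rewrite -natr1 in h2; rewrite /Q in h1 h2 *; lra.
  have /(congr1 (fun n => n%:R : R)) := recq k.
  rewrite natrD natrM -/(Q _) -/(Q _) -/(Q _) => E.
  have := Q4 k; have := Q0 k; have := Q1 k.+1; move: aitv t1.
  rewrite tE; move: (Q k.+1 `^ _) (_%:R) E => t b E /andP[tb bt] t1 Qp1 Qp0 Qp4.
  have -> : Q k.+2 = b * Q k.+1 - Q k by rewrite -E addrK.
  have QQ : 0 < Q k.+1 * Q k.+1 by rewrite mulr_gt0.
  have QQ' : Q k.+1 * Q k <= Q k.+1 * Q k.+1 by rewrite ler_pM2l//; lra.
  have QQ'' : 0 <= Q k.+1 * Q k by rewrite mulr_ge0// ltW.
  have := ler_wpM2r (ltW QQ) tb; have := ler_wpM2r (ltW QQ) bt.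
  have := ler_wpM2r (ltW QQ) t1.
  nra.
have q_ge k : (k < q k)%N.
  by elim: k => // k; have := q4 k; lia.
have sep k (n : nat) (m : int) : (0 < n)%N -> (4 * n <= q k.+1)%N ->
    m%:~R / n%:R = r k :> R \/ (2 * n%:R * Q k)^-1 <= `|x - m%:~R / n%:R|.
  move=> n0 nq; have [E|NE] := pselect (m * (q k)%:Z = p k * n%:Z).
    left; have /(congr1 (fun z => z%:~R : R)) := E.
    rewrite !rmorphM /= -!pmulrn => h.
    by apply/eqP; rewrite eqr_div ?lt0r_neq0 ?ltr0n// h.
  by right; apply: (dist_frac_ge (q' := q k.+1)) NE => //; exact: xr0.
exists x, p, q; split.
- by move=> k; have := q0 k; have := q4 k; lia.
- move=> n m n0.
  have N1 : 1 <= n%:R :> R by rewrite ler1n.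
  have [k [nk qk]] : exists k, (4 * n <= q k.+1)%N /\ (q k < 4 * n)%N.
    have ex : exists k, (4 * n <= q k)%N.
      by exists (4 * n)%N; exact/ltnW/q_ge.
    case: (ex_minnP ex) => -[|k] h hmin; first by rewrite q0E in h; lia.
    by exists k; split => //; rewrite ltnNge; apply/negP => /hmin; lia.
  have QN : Q k <= 4 * n%:R by rewrite -natrM ler_nat ltnW.
  (* If m / n = p_k / q_k, the distance is at least d_k >= 1 / (6 q_k^tau), with q_k < 4 n.
     Otherwise it is at least 1 / (2 n q_k), of order n^(-2), and tau > 2 concludes. *)
  rewrite powRN -invfM.
  have [->|] := sep k n m n0 nk.
    have /andP[h _] := xrk k; rewrite ger0_norm; last by case/andP: (xr0 k).
    apply: le_trans h; rewrite lef_pV2 ?posrE ?mulr_gt0 ?powR_gt0//; last first.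
      by lra.
    have /andP[_ h] := growth k; apply: le_trans h _.
    have : Q k `^ tau <= (4 * n%:R) `^ tau.
      apply: ge0_ler_powR => //; rewrite ?nnegrE ?mulr_ge0//; lra.
    have := powR_gt0 tau (Q0 k); lra.
  apply: le_trans; rewrite lef_pV2 ?posrE ?mulr_gt0 ?powR_gt0//; try by lra.
  apply: (@le_trans _ _ (8 * (4 * n%:R) ^+ 2)); first by nra.
  rewrite ler_pM2l//.
  rewrite -powR_mulrn; last by lra.
  by apply: ler_powR; lra.
- move=> k; have /andP[h0 h] := xr0 k; rewrite ger0_norm//.
  apply: le_trans h _; rewrite ler_pM2l// powRN -/(Q k).
  rewrite lef_pV2 ?posrE ?mulr_gt0 ?powR_gt0//.
  by case/andP: (growth k).
- move=> k n m /andP[n0 nq].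
  (* The growth factor 4 brings every n <= q_k within reach of [sep], whose bound 1 / (2 n q_k) is
     then at least 2 d_k. *)
  have nq4 : (4 * n <= q k.+1)%N by have := q4 k; lia.
  have [->|] := sep k n m n0 nq4; first exact: lexx.
  apply: le_trans; have /andP[h0 h] := xr0 k; rewrite ger0_norm//.
  apply: le_trans h _.
  have N0 : 0 < n%:R :> R by rewrite ltr0n.
  have NQ : n%:R <= Q k by rewrite ler_nat.
  rewrite -[X in X * _](invrK 2) -invfM lef_pV2 ?posrE ?mulr_gt0 ?invr_gt0//.
  have := Q4 k; have := Q0 k; nra.
Qed.
Theorem theorem1p5 (R : realType) (omega : R -> R)
    (omega_pos : maps_pos_to_pos omega) (tau : R) (tau_gt2 : 2 < tau) :
  exists Psi : R -> R,
    [/\ maps_pos_to_pos Psi,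
        {in `]0, +oo[ &, {homo Psi : x y /~ x <= y}},
        - ln (Psi q) / ln q @[q --> +oo] --> tau
      & E Psi omega !=set0].
Proof.
have tau0 : 0 <= tau by lra.
have [x [p [q [qS x_low x_up x_best]]]] := ex_order_with_record_fractions tau_gt2.
(* The fractions allowed increase with t, which makes [Psi] non-increasing. The factor 2 is that of
   [x_up], so at t = q_k the power term does not undercut p_k / q_k. *)
pose D (t : R) := [set 2 * t `^ (- tau)] `|`
  [set z | exists (n : nat) (m : int),
     [/\ (0 < n)%N, n%:R <= t & z = `|x - m%:~R / n%:R|]].
pose Psi t := inf (D t).
have powRN_anti (s t : R) : 0 < s -> s <= t -> t `^ (- tau) <= s `^ (- tau).
  move=> s0 st; have t0 := lt_le_trans s0 st.
  rewrite !powRN lef_pV2 ?posrE ?powR_gt0//.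
  by apply: ge0_ler_powR => //; rewrite nnegrE ltW.
(* The constant of [x_low], once (4 n)^(-tau) is split and n <= t is used. *)
pose c : R := 8^-1 * 4 `^ (- tau).
have c8 : c <= 8^-1.
  rewrite ler_piMr// -[leRHS](powRr0 4) ler_powR//; lra.
have D_lb t : 0 < t -> lbound (D t) (c * t `^ (- tau)).
  move=> t0 _ [->|[n [m [n0 nt ->]]]].
    by rewrite ler_wpM2r ?powR_ge0//; lra.
  apply: le_trans (x_low n m n0); rewrite /c -mulrA ler_pM2l//.
  rewrite -powRM//; last by exact: ltW.
  by apply: powRN_anti; rewrite ?ler_pM2l// mulr_gt0// ltr0n.
have D_has_lb t : 0 < t -> has_lbound (D t).
  by move=> t0; exists (c * t `^ (- tau)); exact: D_lb.
have D0 t : D t !=set0 by exists (2 * t `^ (- tau)); left.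
have Psi_bounds t : 0 < t -> c * t `^ (- tau) <= Psi t <= 2 * t `^ (- tau).
  move=> t0; apply/andP; split; first by apply: lb_le_inf => //; exact: D_lb.
  by apply: ge_inf; [exact: D_has_lb|left].
have c0 : 0 < c by rewrite mulr_gt0// powR_gt0.
have Psi_pos : maps_pos_to_pos Psi.
  move=> t t0; have /andP[h _] := Psi_bounds t t0.
  by apply: lt_le_trans h; rewrite mulr_gt0// powR_gt0.
have Psi_le n (m : int) : (0 < n)%N -> Psi n%:R <= `|x - m%:~R / n%:R|.
  move=> n0; apply: ge_inf; first by apply: D_has_lb; rewrite ltr0n.
  by right; exists n, m.
exists Psi; split => //.
- move=> s t; rewrite !in_itv /= !andbT => s0 t0 ts.
  apply: lb_le_inf => // _ [->|[n [m [n0 nt ->]]]].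
    have /andP[_ h] := Psi_bounds s s0; apply: le_trans h _.
    by rewrite ler_pM2l// powRN_anti.
  apply: ge_inf; first exact: D_has_lb.
  by right; exists n, m; split => //; exact: le_trans ts.
- exact: (cvg_Nln_div_ln c0 (ltr0n R 2)).
- exists x; split; last first.
    (* Since [omega n] > 0, the required bound is at most [Psi n], which no fraction of denominator
       n beats. *)
    near=> n => m; have n0 : (0 < n)%N by near: n; exact: nbhs_infty_gt.
    apply: le_trans (Psi_le n m n0); apply: ler_piMl.
      by rewrite ltW// Psi_pos// ltr0n.
    by rewrite gerBl ltW// omega_pos// ltr0n.
  have q_inj : injective q.
    apply/incn_inj/leq_mono; apply: homo_ltn => [? ? ?|k]; first exact: ltn_trans.
    by case/andP: (qS k).
  have pq_inj : injective (fun k => (p k, q k)) by move=> i j [_ /q_inj].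
  (* A finite set of solutions would have a finite preimage under k -> (p_k, q_k), but every k lies
     in it: all members of [D] at q_k are at least |x - p_k / q_k|. *)
  apply: contra_not infinite_nat => /(finite_preimage (in2W pq_inj)).
  apply: sub_finite_set => k _ /=; have /andP[qk0 _] := qS k; split => //.
  apply: lb_le_inf => // _ [->|[n [m [n0 nt ->]]]]; first exact: x_up.
  by apply: x_best; rewrite n0 -(ler_nat R).
Unshelve. all: by end_near. Qed.
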